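(* Let $\mathcal{R}$ be the Reuleaux triangle with vertices $V_1,V_2,V_3$, made of arcs of circles of radius $r$, and let the pedal point $M$ lie on the side (arc) $V_1V_2$ of $\mathcal{R}$. Then the negative pedal curve $\mathcal{N}$ of $\mathcal{R}$ with respect to $M$ consists of two elliptic arcs, lying on ellipses $\mathcal{E}_A$ and $\mathcal{E}_B$, and a point $P_0$, the antipode of $M$ with respect to the center $V_3$ of the circle on which $M$ is located. The two ellipses $\mathcal{E}_A,\mathcal{E}_B$ are centered at the Reuleaux vertices $V_1$ and $V_2$ respectively, have one common focus at $M$, and their semi-major axes have length $r$.
   Context: Let $V_1V_2V_3$ be an equilateral triangle in the plane with side length $r$. The Reuleaux triangle $\mathcal{R}$ is the closed convex curve formed by three circular arcs (its sides) of radius $r$: the arc $V_iV_j$ has center $V_k$ and is the minor ($60^\circ$) arc from $V_i$ to $V_j$, $\{i,j,k\}=\{1,2,3\}$. The negative pedal curve of a curve with respect to a pedal point $M$ is the envelope of the lines through points $P$ of the curve and perpendicular to $PM$. The negative pedal curve $\mathcal{N}$ of $\mathcal{R}$ is made up of the negative pedal curves of its three sides.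
   Formalization: M is assumed to differ from the vertices V1 and V2: at M = V1 the ellipse centered at V2 with focus M and semi-major axis r degenerates and the negative pedal of side V3V1 is a single point, not an elliptic arc (likewise at M = V2). *)

(* Defs.v *)
(* The Euclidean plane is 'rV[R]_2; the library norm on
   'rV[R]_2 is the sup norm, so the Euclidean structure is set up here. *)
From HB Require Import structures.
From mathcomp Require Import all_boot all_order all_algebra.
From mathcomp Require Import all_classical all_reals all_analysis.
Set Implicit Arguments.
Unset Strict Implicit.
Unset Printing Implicit Defensive.
Import Order.TTheory GRing.Theory Num.Theory.
Import numFieldNormedType.Exports.
Local Open Scope classical_set_scope.
Local Open Scope ring_scope.

Definition dotp (R : realType) (u v : 'rV[R]_2) : R :=
  \sum_(i < 2) u ord0 i * v ord0 i.

Definition eucl_dist (R : realType) (X Y : 'rV[R]_2) : R :=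
  Num.sqrt (dotp (X - Y) (X - Y)).

(* (x, y) |-> (- y, x) *)
Definition quarter_turn (R : realType) (u : 'rV[R]_2) : 'rV[R]_2 :=
  \row_(i < 2) (if i == ord0 then - u ord0 ord_max else u ord0 ord0).

(* The 60 degree circular arc with centre C from P to Q, for an equilateral
   triangle C P Q of either orientation, parametrized on [0, pi/3] by the
   central angle measured from P (spherical linear interpolation). *)
Definition arc60 (R : realType) (C P Q : 'rV[R]_2) (t : R) : 'rV[R]_2 :=
  C + (sin (pi / 3 - t) / sin (pi / 3)) *: (P - C)
    + (sin t / sin (pi / 3)) *: (Q - C).

Definition side (R : realType) (C P Q : 'rV[R]_2) : set 'rV[R]_2 :=
  arc60 C P Q @` `[0, pi / 3].

(* Envelope of the curves F(., t) = 0, t in D: the points X satisfying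
   F(X, t) = 0 and dF/dt (X, t) = 0 for some t in D. *)
Definition envelope (R : realType) (F : 'rV[R]_2 -> R -> R) (D : set R) :
    set 'rV[R]_2 :=
  [set X | exists2 t : R, D t & F X t = 0 /\ is_derive t (1 : R) (F X) (0 : R)].

(* The line through P = gamma t perpendicular to PM is the zero set of
   X |-> (X - P) . (P - M); it is defined only when P <> M, so parameters at
   which the curve passes through M are discarded. *)
Definition negative_pedal (R : realType) (gamma : R -> 'rV[R]_2) (D : set R)
    (M : 'rV[R]_2) : set 'rV[R]_2 :=
  envelope (fun X t => dotp (X - gamma t) (gamma t - M))
           (D `&` [set t | gamma t <> M]).

Definition reuleaux_negative_pedal (R : realType) (V1 V2 V3 M : 'rV[R]_2) :
    set 'rV[R]_2 :=
  negative_pedal (arc60 V3 V1 V2) `[0, pi / 3] M `|`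
  negative_pedal (arc60 V1 V2 V3) `[0, pi / 3] M `|`
  negative_pedal (arc60 V2 V3 V1) `[0, pi / 3] M.

(* Nondegenerate ellipses, circles included; [ell_axis] is a unit vector along the
   major axis. *)
Record ellipse (R : realType) := Ellipse {
  ell_center : 'rV[R]_2;
  ell_axis : 'rV[R]_2;
  semimajor : R;
  semiminor : R;
  axis_unit : dotp ell_axis ell_axis = 1;
  semiminor_gt0 : 0 < semiminor;
  semiminor_le : semiminor <= semimajor
}.

Definition foci (R : realType) (E : ellipse R) : set 'rV[R]_2 :=
  let c := Num.sqrt (semimajor E ^+ 2 - semiminor E ^+ 2) in
  [set X | X = ell_center E + c *: ell_axis E \/
           X = ell_center E - c *: ell_axis E].

Definition ellipse_point (R : realType) (E : ellipse R) (s : R) : 'rV[R]_2 :=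
  ell_center E + (semimajor E * cos s) *: ell_axis E
           + (semiminor E * sin s) *: quarter_turn (ell_axis E).

Definition elliptic_arc (R : realType) (E : ellipse R) (A : set 'rV[R]_2) :
    Prop :=
  exists a b : R,
    [/\ a < b, b < a + 2 * pi & A = ellipse_point E @` `[a, b]].

Definition antipode (R : realType) (C M : 'rV[R]_2) : 'rV[R]_2 :=
  C + (C - M).

(* Main.v *)
Require Import Defs.
From mathcomp Require Import all_boot all_order all_algebra.
From mathcomp Require Import all_classical all_reals all_analysis.
From mathcomp Require Import ring lra.
Import Order.TTheory GRing.Theory Num.Theory.
Import numFieldNormedType.Exports.
Local Open Scope classical_set_scope.
Local Open Scope ring_scope.

(** Fix a side of the Reuleaux triangle, an arc of a circle with centre [C] and
    radius [r], and let [M'] be the antipode of [M] with respect to [C].  The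
    pedal line through [P] is the set of [X] with (X - P).(P - M) = 0.  Since P
    runs on a circle, differentiating this along the arc gives a second linear
    condition which says that X - M' is parallel to the radius P - C.  The two
    conditions together have exactly one solution ([contactP]),

      X = M' + (r^2 - |M - C|^2) / ((P - C).(P - M)) (P - C),

    so the negative pedal curve of the side is the image of the side, without
    [M], under this map [contact C M] ([negative_pedal_arc60]).

    If [M] is on the side itself, then |M - C| = r, the coefficient of P - C
    vanishes and the whole curve collapses to [M'] ([negative_pedal_own_side]).

    If [M] is at distance c < r from [C], let [s] be the angle from M - C to
    P - C.  Then the formula reads X = M' + (r^2 - c^2) / (r - c cos s) u with
    [u] the unit vector along P - C: this is the polar equation, about the
    focus [M'], of the ellipse with centre [C], semi-major axis [r] and foci
    [M] and [M'].  Passing from the polar angle [s] to the eccentric anomaly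
    turns it into the standard parametrization of the ellipse; on [0, pi] this
    change of parameter is an increasing bijection, so an interval of values
    of [s] gives an elliptic arc ([elliptic_contact_arc]).

    It remains to locate [M] as seen from the other two centres.  By the
    inscribed angle theorem, from the vertex [V1] a point [M] of the arc V1V2
    at central angle [tau] from [V1] is at distance 2 r sin (tau / 2) < r,
    in a direction that makes an angle pi/6 - tau/2 with V1V2, outside the
    triangle ([arc60_chord]).  Hence [s] runs over an interval of length pi/3
    contained in [0, pi/2].  The situation at [V2] is the mirror image. *)

Set Implicit Arguments.
Unset Strict Implicit.
Unset Printing Implicit Defensive.

Lemma addrCK {V : zmodType} (x y : V) : x + y - x = y.
Proof. by rewrite addrAC subrr add0r. Qed.

(** * Coordinates and rotations of the plane *)

(** Chained uses certify membership of an equation in the ideal generated by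
    several hypotheses. *)
Lemma lin_comb {R : comNzRingType} (k c d a b : R) :
  c = d -> a = b + k * (c - d) -> a = b.
Proof. by move=> ->; rewrite subrr mulr0 addr0. Qed.
Arguments lin_comb {R} k {c d a b}.

Lemma dotpE {R : realType} (u v : 'rV[R]_2) :
  dotp u v = u ord0 ord0 * v ord0 ord0 + u ord0 ord_max * v ord0 ord_max.
Proof.
rewrite /dotp big_ord_recl big_ord1.
by have -> : lift ord0 ord0 = ord_max :> 'I_2 by apply/val_inj.
Qed.

Lemma quarter_turnE {R : realType} (u : 'rV[R]_2) :
  ((quarter_turn u) ord0 ord0 = - u ord0 ord_max) *
  ((quarter_turn u) ord0 ord_max = u ord0 ord0).
Proof. by rewrite !mxE. Qed.

Definition coordE {R : realType} := (@dotpE R, @quarter_turnE R, @mxE R).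

Lemma dotpZ {R : realType} (a : R) (u : 'rV[R]_2) :
  dotp (a *: u) (a *: u) = a ^+ 2 * dotp u u.
Proof. by rewrite !coordE; ring. Qed.

Lemma vec2P {R : realType} (u v : 'rV[R]_2) :
  u ord0 ord0 = v ord0 ord0 -> u ord0 ord_max = v ord0 ord_max -> u = v.
Proof.
move=> u0 u1; apply/rowP => i.
have [->|->] // : i = ord0 \/ i = ord_max.
by case: i => [[|[|//]] ?]; [left|right]; apply/val_inj.
Qed.

(** Rotation of [u] by the angle [eps * t], for [eps = 1] or [eps = -1].  The
    sign carries the orientation of the triangle, so that both orientations are
    treated at once. *)
Definition rotv {R : realType} (eps t : R) (u : 'rV[R]_2) : 'rV[R]_2 :=
  cos t *: u + (eps * sin t) *: quarter_turn u.

Lemma rotvZ {R : realType} (eps t k : R) (u : 'rV[R]_2) :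
  rotv eps t (k *: u) = k *: rotv eps t u.
Proof. by apply: vec2P; rewrite /rotv !coordE; ring. Qed.

Lemma rotvD {R : realType} (eps s t : R) (u : 'rV[R]_2) : eps ^+ 2 = 1 ->
  rotv eps s (rotv eps t u) = rotv eps (s + t) u.
Proof.
move=> e2; apply: vec2P; rewrite /rotv !coordE cosD sinD.
  by apply: (lin_comb (- (sin s * sin t * u ord0 ord0)) e2); ring.
by apply: (lin_comb (- (sin s * sin t * u ord0 ord_max)) e2); ring.
Qed.

Lemma dotp_rotv {R : realType} (eps t : R) (u : 'rV[R]_2) : eps ^+ 2 = 1 ->
  dotp (rotv eps t u) (rotv eps t u) = dotp u u.
Proof.
move=> e2; apply: (lin_comb (dotp u u) (cos2Dsin2 t)).
apply: (lin_comb (dotp u u * sin t ^+ 2) e2).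
by rewrite /rotv !coordE; ring.
Qed.

(** * Arcs of sixty degrees *)

(** From cos (3 (pi/3)) = -1, the value c satisfies (c + 1)(2c - 1)^2 = 0. *)
Lemma cos_pi3 {R : realType} : cos (pi / 3) = 1 / 2 :> R.
Proof.
have h : 0 < cos (pi / 3 : R).
  by apply: cos_gt0_pihalf; have := pi_gt0 R; lra.
have : cos (pi / 3 + pi / 3 + pi / 3 : R) = - 1.
  by rewrite -[RHS]cospi; congr cos; field.
rewrite !cosD !sinD => c3.
have cs := cos2Dsin2 (pi / 3 : R).
set c := cos (pi / 3) in h c3 cs *; set s := sin (pi / 3) in c3 cs.
have : (c + 1) * (2 * c - 1) ^+ 2 = 0.
  by apply: (lin_comb 1 c3); apply: (lin_comb (3 * c) cs); ring.
move/eqP; rewrite mulf_eq0 sqrf_eq0 => /orP[/eqP|/eqP]; lra.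
Qed.

Lemma sin_pi3_gt0 {R : realType} : 0 < sin (pi / 3) :> R.
Proof. by apply: sin_gt0_pi; have := pi_gt0 R; lra. Qed.

Lemma sin_pi3_sqr {R : realType} : sin (pi / 3) ^+ 2 = 3 / 4 :> R.
Proof. by have := cos2Dsin2 (pi / 3 : R); rewrite cos_pi3; lra. Qed.

Lemma sin_pi6 {R : realType} : sin (pi / 6) = 1 / 2 :> R.
Proof.
rewrite -cosBpihalf -cos_pi3 -[RHS]cosN; congr cos; lra.
Qed.

Lemma eucl_dist_sqr {R : realType} (X Y : 'rV[R]_2) r :
  eucl_dist X Y = r -> dotp (X - Y) (X - Y) = r ^+ 2.
Proof.
by move=> <-; rewrite /eucl_dist sqr_sqrtr // dotpE -!expr2 addr_ge0 ?sqr_ge0.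
Qed.

Lemma eucl_distC {R : realType} (X Y : 'rV[R]_2) :
  eucl_dist X Y = eucl_dist Y X.
Proof. by rewrite /eucl_dist; congr Num.sqrt; rewrite !coordE; ring. Qed.

Lemma arc60_start {R : realType} (C P Q : 'rV[R]_2) : arc60 C P Q 0 = P.
Proof.
rewrite /arc60 subr0 sin0 mul0r scale0r addr0 divff ?gt_eqF ?sin_pi3_gt0 //.
by rewrite scale1r addrC subrK.
Qed.

Lemma arc60_end {R : realType} (C P Q : 'rV[R]_2) : arc60 C P Q (pi / 3) = Q.
Proof.
rewrite /arc60 subrr sin0 mul0r scale0r addr0 divff ?gt_eqF ?sin_pi3_gt0 //.
by rewrite scale1r addrC subrK.
Qed.

Lemma sideC {R : realType} (C P Q : 'rV[R]_2) : side C P Q = side C Q P.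
Proof.
suff sub P' Q' : side C P' Q' `<=` side C Q' P'.
  by apply/seteqP; split; exact: sub.
move=> X [t /= ti <-]; exists (pi / 3 - t).
  by move: ti; rewrite /= !in_itv /= => /andP[? ?]; apply/andP; split; lra.
by rewrite /arc60 subKr addrAC.
Qed.

(** The dot product of P - C and Q - C is r^2 / 2, hence by the Lagrange
    identity their cross product is plus or minus sin (pi/3) r^2; [eps] is its
    sign. *)
Lemma equilateral_rotv {R : realType} (r : R) (C P Q : 'rV[R]_2) : 0 < r ->
  eucl_dist C P = r -> eucl_dist P Q = r -> eucl_dist Q C = r ->
  exists2 eps : R, eps ^+ 2 = 1 & Q - C = rotv eps (pi / 3) (P - C).
Proof.
move=> r0 /eucl_dist_sqr cp /eucl_dist_sqr pq /eucl_dist_sqr qc.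
have k0 := @sin_pi3_gt0 R; have k2 := @sin_pi3_sqr R.
set k := sin (pi / 3) in k0 k2.
move: cp pq qc; rewrite !coordE.
set c0 := C ord0 ord0; set c1 := C ord0 ord_max.
set p0 := P ord0 ord0; set p1 := P ord0 ord_max.
set q0 := Q ord0 ord0; set q1 := Q ord0 ord_max => cp pq qc.
pose z := (p0 - c0) * (q1 - c1) - (p1 - c1) * (q0 - c0).
have dot : (p0 - c0) * (q0 - c0) + (p1 - c1) * (q1 - c1) = r ^+ 2 / 2 by lra.
have r2 : (p0 - c0) ^+ 2 + (p1 - c1) ^+ 2 = r ^+ 2 by lra.
have q2 : (q0 - c0) ^+ 2 + (q1 - c1) ^+ 2 = r ^+ 2 by lra.
have z2 : z ^+ 2 = k ^+ 2 * r ^+ 4.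
  have -> : z ^+ 2 = ((p0 - c0) ^+ 2 + (p1 - c1) ^+ 2) *
    ((q0 - c0) ^+ 2 + (q1 - c1) ^+ 2) -
    ((p0 - c0) * (q0 - c0) + (p1 - c1) * (q1 - c1)) ^+ 2 by rewrite /z; ring.
  by rewrite r2 q2 dot k2; field.
have kn : k != 0 by rewrite gt_eqF.
have rn : r != 0 by rewrite gt_eqF.
have r2n : (p0 - c0) ^+ 2 + (p1 - c1) ^+ 2 != 0 by rewrite r2 expf_neq0.
exists (z / (k * r ^+ 2)).
  by rewrite expr_div_n z2; field; rewrite kn rn.
apply: vec2P; rewrite /rotv !coordE cos_pi3 -/k.
  rewrite -/c0 -/c1 -/p0 -/p1 -/q0 -/q1 /=.
  transitivity (((p0 - c0) * (r ^+ 2 / 2) - (p1 - c1) * z) / r ^+ 2).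
    rewrite -dot -r2 /z; field; exact: r2n.
  by field; rewrite kn rn.
rewrite -/c0 -/c1 -/p0 -/p1 -/q0 -/q1 /=.
transitivity (((p1 - c1) * (r ^+ 2 / 2) + (p0 - c0) * z) / r ^+ 2).
  rewrite -dot -r2 /z; field; exact: r2n.
by field; rewrite kn rn.
Qed.

Lemma arc60_rotv {R : realType} (eps : R) (C P Q : 'rV[R]_2) t :
  Q - C = rotv eps (pi / 3) (P - C) ->
  arc60 C P Q t = C + rotv eps t (P - C).
Proof.
rewrite /arc60 => ->; rewrite sinB /rotv cos_pi3.
have kn : sin (pi / 3) != 0 :> R by rewrite gt_eqF ?sin_pi3_gt0.
by apply: vec2P; rewrite !coordE; field.
Qed.

(** The inscribed angle theorem, for the arc from [C] to [P] of the circle with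
    centre [Q]: the direction of the chord from [C] to the point at central
    angle [t] makes an angle t/2 with the tangent at [C], and that tangent makes
    an angle -pi/6 with the side CP. *)
Lemma arc60_chord {R : realType} (eps : R) (C P Q : 'rV[R]_2) t :
  eps ^+ 2 = 1 -> Q - C = rotv eps (pi / 3) (P - C) ->
  arc60 Q C P t =
    C + (2 * sin (t / 2)) *: rotv eps (t / 2 - pi / 6) (P - C).
Proof.
move=> e2 qc.
have next : P - Q = rotv eps (pi / 3) (C - Q).
  have -> : P - Q = (P - C) - (Q - C) by apply: vec2P; rewrite !coordE; ring.
  have -> : C - Q = (-1) *: (Q - C) by apply: vec2P; rewrite !coordE; ring.
  rewrite rotvZ qc rotvD //; apply: vec2P; rewrite /rotv !coordE.
    rewrite cosD sinD cos_pi3.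
    apply: (lin_comb (- (P - C) ord0 ord0) (@sin_pi3_sqr R)).
    by rewrite !mxE; field.
  rewrite cosD sinD cos_pi3.
  apply: (lin_comb (- (P - C) ord0 ord_max) (@sin_pi3_sqr R)).
  by rewrite !mxE; field.
rewrite (@arc60_rotv _ eps) //.
have -> : C - Q = (-1) *: rotv eps (pi / 3) (P - C).
  by rewrite -qc; apply: vec2P; rewrite !coordE; ring.
have -> : Q = C + rotv eps (pi / 3) (P - C) by rewrite -qc addrC subrK.
rewrite rotvZ rotvD //.
have -> : t / 2 - pi / 6 = (t / 2 + pi / 3) - pi / 2 by field.
have -> : t + pi / 3 = t / 2 + (t / 2 + pi / 3) by field.
have -> : rotv eps (pi / 3) (P - C) =
    rotv eps (- (t / 2) + (t / 2 + pi / 3)) (P - C).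
  by congr rotv; field.
set a := t / 2; set b := a + pi / 3; clearbody b; clearbody a.
apply: vec2P; rewrite /rotv !coordE cosBpihalf sinBpihalf !cosD !sinD cosN sinN;
  by ring.
Qed.

(** * The negative pedal curve of a circular arc *)

(** The contact point with the envelope of the perpendicular to PM at [P], when
    [P] moves on a circle with centre [C]. *)
Definition contact {R : realType} (C M P : 'rV[R]_2) : 'rV[R]_2 :=
  antipode C M +
  ((dotp (P - C) (P - C) - dotp (M - C) (M - C)) / dotp (P - C) (P - M))
    *: (P - C).

(** Nonvanishing of the denominator in [contact]: twice it is the sum of
    |P - M|^2 and of |P - C|^2 - |M - C|^2. *)
Lemma dotp_chord_gt0 {R : realType} (C M P : 'rV[R]_2) :
  dotp (M - C) (M - C) <= dotp (P - C) (P - C) -> P <> M ->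
  0 < dotp (P - C) (P - M).
Proof.
move=> le PM.
have pos : 0 < dotp (P - M) (P - M).
  rewrite lt_neqAle eq_sym dotpE -!expr2 addr_ge0 ?sqr_ge0 // andbT.
  apply/eqP => /eqP; rewrite paddr_eq0 ?sqr_ge0 // !sqrf_eq0 !mxE !subr_eq0.
  by move=> /andP[/eqP h0 /eqP h1]; apply: PM; apply: vec2P.
have : 2 * dotp (P - C) (P - M) =
  dotp (P - M) (P - M) + (dotp (P - C) (P - C) - dotp (M - C) (M - C)).
  by rewrite !coordE; ring.
lra.
Qed.

(** With Y = X - antipode C M, v = P - C and d = M - C the first equation is
    Y.(v - d) = |v|^2 - |d|^2, and the second one says that Y is parallel to v.
    The determinant of this linear system is v.(v - d), which is positive. *)
Lemma contactP {R : realType} (C M P X : 'rV[R]_2) :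
  dotp (M - C) (M - C) <= dotp (P - C) (P - C) -> P <> M ->
  (dotp (X - P) (P - M) = 0 /\
   dotp (X - antipode C M) (quarter_turn (P - C)) = 0)
  <-> X = contact C M P.
Proof.
move=> le PM; have := dotp_chord_gt0 le PM.
rewrite /contact /antipode; set D := dotp _ (P - M) => D0.
have Dn : D != 0 by rewrite gt_eqF.
split=> [[e1 e2]|->].
  set N := _ - dotp (M - C) _.
  suff [h0 h1] :
    (X - antipode C M) ord0 ord0 * D = N * (P - C) ord0 ord0 /\
    (X - antipode C M) ord0 ord_max * D = N * (P - C) ord0 ord_max.
    apply: vec2P; rewrite !mxE -mulrA [_^-1 * _]mulrC mulrA.
      apply: (mulIf Dn); rewrite mulrDl divfK //.
      by move: h0; rewrite /antipode !mxE => <-; ring.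
    apply: (mulIf Dn); rewrite mulrDl divfK //.
    by move: h1; rewrite /antipode !mxE => <-; ring.
  move: e1 e2; rewrite /N /D /antipode !coordE => e1 e2.
  split.
    apply: (lin_comb (P ord0 ord0 - C ord0 ord0) e1).
    by apply: (lin_comb (M ord0 ord_max - P ord0 ord_max) e2); ring.
  apply: (lin_comb (P ord0 ord_max - C ord0 ord_max) e1).
  by apply: (lin_comb (P ord0 ord0 - M ord0 ord0) e2); ring.
split; last by rewrite !coordE; ring.
move: Dn; rewrite /D !coordE => Dn; field; exact: Dn.
Qed.

Lemma is_derive_harmonic {R : realType} (a b k t : R) :
  is_derive t (1 : R) (fun s : R => a * cos s + b * sin s + k)
    (b * cos t - a * sin t).
Proof.
have H := is_deriveD (is_deriveD (is_deriveZ a (is_derive_cos t))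
  (is_deriveZ b (is_derive_sin t))) (is_derive_cst k t 1).
apply: (is_derive_eq H).
by rewrite addr0 /GRing.scale /= mulrN addrC.
Qed.

(** On a circle the quadratic term of (X - P).(P - M) is constant, so this is a
    harmonic function of the angle; its derivative is the scalar product of
    X - antipode C M with the tangent vector at [P]. *)
Lemma negative_pedal_arc60 {R : realType} (r : R) (C P Q M : 'rV[R]_2) :
  0 < r -> eucl_dist C P = r -> eucl_dist P Q = r -> eucl_dist Q C = r ->
  dotp (M - C) (M - C) <= r ^+ 2 ->
  negative_pedal (arc60 C P Q) `[0, pi / 3] M =
  contact C M @` (side C P Q `\ M).
Proof.
move=> r0 cp pq qc le.
have [eps e2 qcE] := equilateral_rotv r0 cp pq qc.
have pp : dotp (P - C) (P - C) = r ^+ 2.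
  by apply: eucl_dist_sqr; rewrite eucl_distC.
have arcE t := arc60_rotv t qcE.
have norm t : dotp (arc60 C P Q t - C) (arc60 C P Q t - C) = r ^+ 2.
  by rewrite arcE addrCK dotp_rotv.
have main t X : arc60 C P Q t <> M ->
  (dotp (X - arc60 C P Q t) (arc60 C P Q t - M) = 0 /\
  is_derive t (1 : R) (fun t => dotp (X - arc60 C P Q t) (arc60 C P Q t - M))
    (0 : R)) <-> X = contact C M (arc60 C P Q t).
  move=> tM; rewrite -contactP ?norm //.
  have : is_derive t (1 : R)
     (fun t => dotp (X - arc60 C P Q t) (arc60 C P Q t - M))
     (eps * dotp (X - antipode C M) (quarter_turn (arc60 C P Q t - C))).
    pose a := dotp (X - antipode C M) (P - C).
    pose b := eps * dotp (X - antipode C M) (quarter_turn (P - C)).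
    have -> : (fun t => dotp (X - arc60 C P Q t) (arc60 C P Q t - M)) =
       (fun s => a * cos s + b * sin s + (- r ^+ 2 - dotp (X - C) (M - C))).
      apply/funext => s; rewrite -(norm s) arcE /rotv.
      by rewrite {}/a {}/b /antipode !coordE; ring.
    apply: (is_derive_eq (is_derive_harmonic _ _ _ _)).
    apply: (lin_comb (sin t * dotp (X - antipode C M) (P - C)) e2).
    by rewrite arcE /rotv /a /b /antipode !coordE; ring.
  move=> dF; split=> -[h1 h2]; split=> //.
    have := @derive_val _ _ _ _ _ _ _ dF; rewrite derive_val.
    move/esym/eqP; rewrite mulf_eq0 => /orP[/eqP eps0|/eqP//].
    by move: e2; rewrite eps0 expr0n => /esym/eqP; rewrite oner_eq0.
  by move: dF; rewrite h2 mulr0.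
rewrite /negative_pedal /envelope; apply/seteqP; split=> X /=.
  case=> t [tI tM] /main; move=> /(_ tM) ->.
  by exists (arc60 C P Q t) => //; split=> //; exists t.
case=> _ [[t tI <-] tM] <-; exists t; first by [].
exact/main.
Qed.

(** * Eccentric anomaly *)

(** The cosine of the eccentric anomaly as a function of the cosine [x] of the
    angle at the centre [C] between [M] and [P], for semi-major axis [r] and
    focal distance [c].  It is a Moebius map that preserves the interval
    [-1, 1]. *)
Definition ecos {R : realType} (r c x : R) : R := (r * x - c) / (r - c * x).

Lemma focal_radius_gt0 {R : realType} (r c x : R) :
  0 < c < r -> -1 <= x <= 1 -> 0 < r - c * x.
Proof. by move=> /andP[? ?] /andP[? ?]; nra. Qed.

Lemma ecos_bound {R : realType} (r c x : R) : 0 < c < r -> -1 <= x <= 1 ->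
  -1 <= ecos r c x <= 1.
Proof.
move=> cr x1; have D0 := focal_radius_gt0 cr x1.
rewrite /ecos ler_pdivlMr // ler_pdivrMr //.
by move: cr x1 => /andP[? ?] /andP[? ?]; apply/andP; split; nra.
Qed.

(** Cross-multiplying the two sides leaves (y - x)(r^2 - c^2) > 0. *)
Lemma ltr_ecos {R : realType} (r c : R) : 0 < c < r ->
  {in `[-1, 1] &, {mono ecos r c : x y / x < y}}.
Proof.
move=> cr; apply: leW_mono_in; apply: le_mono_in => x y.
rewrite !in_itv /= => x1 y1 xy.
have Dx := focal_radius_gt0 cr x1; have Dy := focal_radius_gt0 cr y1.
rewrite /ecos ltr_pdivrMr // mulrAC ltr_pdivlMr //.
have : 0 < (y - x) * (r ^+ 2 - c ^+ 2).
  by rewrite mulr_gt0 ?subr_gt0 //; move: cr => /andP[? ?]; nra.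
nra.
Qed.

Lemma oppr_itv1 {R : realType} (x : R) : (-1 <= - x <= 1) = (-1 <= x <= 1).
Proof. by rewrite lerN2 lerNl andbC. Qed.

(** The inverse Moebius map is obtained by changing [c] into [-c], that is, by
    conjugating with x |-> -x. *)
Lemma ecosK {R : realType} (r c x : R) : 0 < c < r -> -1 <= x <= 1 ->
  ecos r c (- ecos r c (- x)) = x.
Proof.
move=> cr x1.
have x1' : -1 <= - x <= 1 by rewrite oppr_itv1.
have D := focal_radius_gt0 cr x1'.
have e1 : -1 <= - ecos r c (- x) <= 1.
  by rewrite oppr_itv1; exact: ecos_bound.
have D' := focal_radius_gt0 cr e1.
move: cr D' D => /andP[c0 ccr]; rewrite /ecos => D' D.
have Dn : r - c * - x != 0 by rewrite gt_eqF.
have D'n : r ^+ 2 - c ^+ 2 != 0 by rewrite gt_eqF //; nra.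
field; rewrite Dn /=.
by have -> : r * (r - c * - x) - c * - (r * - x - c) = r ^+ 2 - c ^+ 2 by ring.
Qed.

Definition eccentric_anomaly {R : realType} (r c s : R) : R :=
  acos (ecos r c (cos s)).

Lemma cos_itv {R : realType} (s : R) : -1 <= cos s <= 1.
Proof. by rewrite cos_geN1 cos_le1. Qed.

Lemma eccentric_anomaly_itv {R : realType} (r c s : R) : 0 < c < r ->
  0 <= eccentric_anomaly r c s <= pi.
Proof.
by move=> cr; rewrite acos_ge0 ?acos_lepi //; exact/ecos_bound/cos_itv.
Qed.

Lemma cos_eccentric_anomaly {R : realType} (r c s : R) : 0 < c < r ->
  cos (eccentric_anomaly r c s) = ecos r c (cos s).
Proof. by move=> cr; rewrite acosK // in_itv /=; exact/ecos_bound/cos_itv. Qed.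

(** The angle is in [0, pi], so both sides are nonnegative and it is enough to
    compare squares. *)
Lemma sin_eccentric_anomaly {R : realType} (r c s : R) : 0 < c < r ->
  0 <= s <= pi ->
  Num.sqrt (r ^+ 2 - c ^+ 2) * sin (eccentric_anomaly r c s) =
  (r ^+ 2 - c ^+ 2) * sin s / (r - c * cos s).
Proof.
move=> cr spi; have D := focal_radius_gt0 cr (cos_itv s).
have N0 : 0 <= r ^+ 2 - c ^+ 2 by move: cr => /andP[? ?]; nra.
rewrite sin_acos; last exact/ecos_bound/cos_itv.
rewrite -sqrtrM //.
have sin0 := sin_ge0_pi spi.
rewrite -[RHS]ger0_norm; last by rewrite divr_ge0 ?mulr_ge0 // ltW.
rewrite -sqrtr_sqr; congr Num.sqrt.
have Dn : r - c * cos s != 0 by rewrite gt_eqF.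
rewrite [in RHS]expr_div_n (exprMn 2 _ (sin s)) sin2cos2 /ecos.
by field; exact: Dn.
Qed.

Lemma ltr_eccentric_anomaly {R : realType} (r c : R) : 0 < c < r ->
  {in `[0, pi] &, {mono eccentric_anomaly r c : s t / s < t}}.
Proof.
move=> cr s t si ti.
rewrite -ltr_cos ?in_itv /= ?eccentric_anomaly_itv //.
by rewrite !cos_eccentric_anomaly // ltr_ecos ?in_itv /= ?cos_itv // ltr_cos.
Qed.

Lemma eccentric_anomaly_surj {R : realType} (r c E : R) : 0 < c < r ->
  0 <= E <= pi -> exists2 s, 0 <= s <= pi & eccentric_anomaly r c s = E.
Proof.
move=> cr Ei.
have e1 : -1 <= - ecos r c (- cos E) <= 1.
  by rewrite oppr_itv1 ecos_bound // oppr_itv1 cos_itv.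
exists (acos (- ecos r c (- cos E))); first by rewrite acos_ge0 ?acos_lepi.
rewrite /eccentric_anomaly acosK ?in_itv //= ecosK ?cos_itv // cosK //.
Qed.

(** * Elliptic arcs *)

(** The contact point in the orthonormal frame of the major axis: the polar
    equation about the focus [antipode C M], written in Cartesian form. *)
Lemma contact_polar {R : realType} (eps r c s : R) (C e : 'rV[R]_2) :
  eps ^+ 2 = 1 -> dotp e e = 1 -> 0 < c < r ->
  contact C (C + c *: e) (C + r *: rotv eps s e) =
  C + (r * ecos r c (cos s)) *: e +
    (eps * ((r ^+ 2 - c ^+ 2) * sin s / (r - c * cos s))) *: quarter_turn e.
Proof.
move=> eps2 ee cr; have D := focal_radius_gt0 cr (cos_itv s).
have r0 : r != 0 by move: cr => /andP[? ?]; rewrite gt_eqF //; lra.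
have Dn : r - c * cos s != 0 by rewrite gt_eqF.
rewrite /contact.
have -> : dotp (C + r *: rotv eps s e - C)
    (C + r *: rotv eps s e - (C + c *: e))
    = r * (r - c * cos s).
  apply: (lin_comb (r * (r - c * cos s)) ee).
  transitivity (dotp (r *: rotv eps s e) (r *: rotv eps s e) -
                r * c * cos s * dotp e e); first by rewrite /rotv !coordE; ring.
  by rewrite dotpZ dotp_rotv //; ring.
rewrite addrCK dotpZ dotp_rotv // ee.
rewrite addrCK dotpZ ee !mulr1.
rewrite /antipode /ecos; apply: vec2P; rewrite /rotv !coordE; field;
  by rewrite Dn r0.
Qed.

(** By [contact_polar] and the formulas for the sine and cosine of the eccentric
    anomaly E, the contact point is the point of the ellipse with parameter
    [eps * E]; E increases bijectively from [0, pi] to [0, pi], so it sends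
    [s0, s1] onto an interval. *)
Lemma elliptic_contact_arc {R : realType} (eps r c s0 s1 : R)
    (C e : 'rV[R]_2) :
  eps ^+ 2 = 1 -> dotp e e = 1 -> 0 < c < r -> 0 <= s0 -> s0 < s1 -> s1 <= pi ->
  exists E : ellipse R,
    [/\ ell_center E = C, semimajor E = r,
        foci E = [set C + c *: e; antipode C (C + c *: e)] &
        elliptic_arc E (contact C (C + c *: e) @`
          ((fun s => C + r *: rotv eps s e) @` `[s0, s1]))].
Proof.
move=> eps2 ee cr s0_ge0 s01 s1_lepi.
have [c0 ccr] := andP cr.
have N0 : 0 < r ^+ 2 - c ^+ 2 by nra.
have b0 : 0 < Num.sqrt (r ^+ 2 - c ^+ 2) by rewrite sqrtr_gt0.
have br : Num.sqrt (r ^+ 2 - c ^+ 2) <= r.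
  have r0 : 0 <= r by lra.
  rewrite -[leRHS]ger0_norm // -sqrtr_sqr ler_sqrt ?sqr_ge0 //.
  by rewrite gerBl sqr_ge0.
pose El := @Ellipse R C e r _ ee b0 br.
exists El; split=> //.
  rewrite /foci /= sqr_sqrtr ?(ltW N0) // subKr sqrtr_sqr.
  rewrite ger0_norm ?(ltW c0) //.
  have -> // : antipode C (C + c *: e) = C - c *: e.
    by apply: vec2P; rewrite /antipode !coordE; ring.
pose a := eccentric_anomaly r c s0; pose b := eccentric_anomaly r c s1.
have s0i : s0 \in `[0, pi] by rewrite in_itv /= s0_ge0; lra.
have s1i : s1 \in `[0, pi] by rewrite in_itv /= s1_lepi andbT; lra.
have ab : a < b by rewrite ltr_eccentric_anomaly.
have pi0 := @pi_gt0 R.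
have /andP[a0 api] : 0 <= a <= pi := eccentric_anomaly_itv s0 cr.
have /andP[bge0 bpi] : 0 <= b <= pi := eccentric_anomaly_itv s1 cr.
have epsP : eps = 1 \/ eps = -1.
  by move/eqP: eps2; rewrite sqrf_eq1 => /orP[]/eqP; [left|right].
have itvE s : s \in `[0, pi] ->
    (s \in `[s0, s1]) = (eccentric_anomaly r c s \in `[a, b]).
  move=> si; rewrite !in_itv /= !leNgt.
  by rewrite !ltr_eccentric_anomaly.
have sub s : s \in `[s0, s1] -> s \in `[0, pi].
  by rewrite !in_itv /= => /andP[? ?]; apply/andP; split; lra.
have ptE s : s \in `[0, pi] ->
    contact C (C + c *: e) (C + r *: rotv eps s e) =
    ellipse_point El (eps * eccentric_anomaly r c s).
  rewrite in_itv /= => si; rewrite contact_polar // /ellipse_point /=.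
  rewrite -sin_eccentric_anomaly // -cos_eccentric_anomaly //.
  case: epsP => ->; rewrite ?mul1r // !mulN1r cosN sinN mulrN //.
have -> : contact C (C + c *: e) @`
    ((fun s => C + r *: rotv eps s e) @` `[s0, s1]) =
    (fun E => ellipse_point El (eps * E)) @` `[a, b].
  apply/seteqP; split=> X /=.
    case=> _ [s si <-] <-; exists (eccentric_anomaly r c s).
      by rewrite /= -itvE ?sub.
    by rewrite ptE ?sub.
  case=> E Ei <-.
  have [s si sE] : exists2 s, 0 <= s <= pi & eccentric_anomaly r c s = E.
    apply: eccentric_anomaly_surj => //; move: Ei; rewrite /= in_itv /=.
    by move=> /andP[? ?]; apply/andP; split; lra.
  have si' : s \in `[0, pi] by rewrite in_itv.
  exists (C + r *: rotv eps s e); last by rewrite ptE // sE.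
  by exists s => //=; rewrite itvE // sE.
case: epsP => ->.
  exists a, b; split=> //; first lra.
  by congr (_ @` _); apply/funext => E; rewrite mul1r.
(* for the negative orientation the arc is described backwards *)
exists (- b), (- a); split; [lra | lra |].
apply/seteqP; split=> X /= [E + <-]; rewrite !in_itv /= => Ei; exists (- E);
  rewrite ?mulN1r ?opprK //; rewrite /= in_itv /= ?lerN2 andbC //.
by rewrite lerNl lerNr.
Qed.

(** * The sides of the Reuleaux triangle *)

(** For a side with centre [C] and a point [M] of another side, with centre [Q].
    The last conclusion allows the arc to be run in the opposite direction: the
    two vertices next to [M] are exchanged by a reflection, which reverses the
    cyclic order of the vertices. *)
Lemma negative_pedal_side {R : realType} (r : R) (C P Q M : 'rV[R]_2) :
  0 < r -> eucl_dist C P = r -> eucl_dist P Q = r -> eucl_dist Q C = r ->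
  side Q C P M -> M <> C -> M <> P ->
  exists E : ellipse R,
    [/\ ell_center E = C, semimajor E = r, foci E = [set M; antipode C M],
        elliptic_arc E (negative_pedal (arc60 C P Q) `[0, pi / 3] M) &
        negative_pedal (arc60 C Q P) `[0, pi / 3] M =
        negative_pedal (arc60 C P Q) `[0, pi / 3] M].
Proof.
move=> r0 cp pq qc [tau taui tauE] MC MP.
have [eps e2 qcE] := equilateral_rotv r0 cp pq qc.
have pp : dotp (P - C) (P - C) = r ^+ 2.
  by apply: eucl_dist_sqr; rewrite eucl_distC.
have pi0 := @pi_gt0 R.
have tau0 : tau != 0.
  by apply/eqP => t0; apply: MC; rewrite -tauE t0 arc60_start.
have tau1 : tau != pi / 3.
  by apply/eqP => t0; apply: MP; rewrite -tauE t0 arc60_end.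
move: taui; rewrite /= in_itv /= le_eqVlt eq_sym (negbTE tau0) /=.
rewrite le_eqVlt (negbTE tau1) /= => /andP[tau_gt0 tau_lt].
(* unit vector from C to M, and the distance from C to M *)
pose e := rotv eps (tau / 2 - pi / 6) (r^-1 *: (P - C)).
pose c := 2 * sin (tau / 2) * r.
have rn : r != 0 by rewrite gt_eqF.
have ee : dotp e e = 1 by rewrite /e dotp_rotv // dotpZ pp; field.
have ME : M = C + c *: e.
  rewrite -tauE (arc60_chord _ e2 qcE) /c /e rotvZ scalerA.
  by rewrite -mulrA divff // mulr1.
have cr : 0 < c < r.
  have sp : 0 < sin (tau / 2) by apply: sin_gt0_pi; lra.
  have : sin (tau / 2) < 1 / 2.
    by rewrite -sin_pi6 ltr_sin ?in_itv /=; [lra | lra | lra].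
  by rewrite /c; move=> ?; apply/andP; split; nra.
have le : dotp (M - C) (M - C) <= r ^+ 2.
  rewrite ME addrCK dotpZ ee; move: cr => /andP[? ?]; nra.
have npE := negative_pedal_arc60 r0 cp pq qc le.
have npE' : negative_pedal (arc60 C Q P) `[0, pi / 3] M =
    negative_pedal (arc60 C P Q) `[0, pi / 3] M.
  rewrite npE sideC; apply: negative_pedal_arc60 le => //.
  - by rewrite eucl_distC.
  - by rewrite eucl_distC.
  - by rewrite eucl_distC.
(* angle from M to P, the start of the arc *)
pose s0 : R := pi / 6 - tau / 2.
have [E [E1 E2 E3 E4]] := @elliptic_contact_arc R eps r c s0 (s0 + pi / 3) C e
  e2 ee cr ltac:(rewrite /s0; lra) ltac:(rewrite /s0; lra)
  ltac:(rewrite /s0; lra).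
exists E; split=> //; first by rewrite ME.
rewrite npE; move: E4; rewrite -ME.
suff -> : (fun s => C + r *: rotv eps s e) @` `[s0, s0 + pi / 3] =
  side C P Q `\ M by [].
have ptE t : arc60 C P Q t = C + r *: rotv eps (t + s0) e.
  rewrite (arc60_rotv _ qcE) /e rotvD // rotvZ scalerA divff // scale1r.
  by congr (_ + rotv _ _ _); rewrite /s0; ring.
have offM s : C + r *: rotv eps s e <> M.
  rewrite ME => /addrI /(congr1 (fun u => dotp u u)).
  rewrite !dotpZ dotp_rotv // ee; move: cr => /andP[? ?]; nra.
apply/seteqP; split=> X /=.
  case=> s si <-; split=> //; exists (s - s0); last by rewrite ptE subrK.
  by move: si; rewrite /= !in_itv /= => /andP[? ?]; apply/andP; split; lra.
case=> -[t ti <-] _; exists (t + s0); last by rewrite ptE.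
by move: ti; rewrite /= !in_itv /= => /andP[? ?]; apply/andP; split; lra.
Qed.

(** [M] and the points of the arc are equidistant from [C], so the coefficient
    in [contact] is zero.  The curve is not empty because [P] differs from
    [M]. *)
Lemma negative_pedal_own_side {R : realType} (r : R) (C P Q M : 'rV[R]_2) :
  0 < r -> eucl_dist C P = r -> eucl_dist P Q = r -> eucl_dist Q C = r ->
  side C P Q M -> M <> P ->
  negative_pedal (arc60 C P Q) `[0, pi / 3] M = [set antipode C M].
Proof.
move=> r0 cp pq qc Mside MP.
have [eps e2 qcE] := equilateral_rotv r0 cp pq qc.
have pp : dotp (P - C) (P - C) = r ^+ 2.
  by apply: eucl_dist_sqr; rewrite eucl_distC.
have norm X : side C P Q X -> dotp (X - C) (X - C) = r ^+ 2.
  case=> t _ <-; rewrite (arc60_rotv _ qcE) addrCK.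
  by rewrite dotp_rotv.
rewrite (negative_pedal_arc60 r0 cp pq qc); last by rewrite norm.
have contactE X : side C P Q X -> contact C M X = antipode C M.
  by move=> sX; rewrite /contact !norm // subrr mul0r scale0r addr0.
apply/seteqP; split=> X /=; first by case=> Y [sY _] <-; exact: contactE.
have sP : side C P Q P.
  exists 0; last exact: arc60_start.
  by rewrite /= in_itv /= lexx /=; have := @pi_gt0 R; lra.
move=> ->; exists P; last exact: contactE.
by split=> // /esym.
Qed.

Theorem proposition1 (R : realType) (r : R) (V1 V2 V3 M : 'rV[R]_2)
    (r_gt0 : 0 < r)
    (h12 : eucl_dist V1 V2 = r) (h23 : eucl_dist V2 V3 = r) (h31 : eucl_dist V3 V1 = r)
    (hM : side V3 V1 V2 M) (hM1 : M <> V1) (hM2 : M <> V2) :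
  exists (EA EB : ellipse R) (A B : set 'rV[R]_2),
    [/\ reuleaux_negative_pedal V1 V2 V3 M = A `|` B `|` [set antipode V3 M],
        elliptic_arc EA A /\ elliptic_arc EB B,
        ell_center EA = V1 /\ ell_center EB = V2,
        foci EA `&` foci EB = [set M] &
        semimajor EA = r /\ semimajor EB = r].
Proof.
have [EA [A1 A2 A3 A4 _]] := negative_pedal_side r_gt0 h12 h23 h31 hM hM1 hM2.
have hM' : side V3 V2 V1 M by rewrite sideC.
have [EB [B1 B2 B3 B4 B5]] : exists E : ellipse R, [/\ _, _, _, _ & _] :=
  negative_pedal_side r_gt0 (etrans (eucl_distC _ _) h12)
    (etrans (eucl_distC _ _) h31) (etrans (eucl_distC _ _) h23) hM' hM2 hM1.
exists EA, EB, (negative_pedal (arc60 V1 V2 V3) `[0, pi / 3] M),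
  (negative_pedal (arc60 V2 V1 V3) `[0, pi / 3] M); split=> //.
  rewrite /reuleaux_negative_pedal B5.
  rewrite (negative_pedal_own_side r_gt0 h31 h12 h23) //.
  by rewrite -setUA setUC.
(* the other foci are distinct, as antipodes of M about distinct centres *)
rewrite A3 B3; apply/seteqP; split=> X /=; last by move=> ->; split; left.
case=> -[->|->] [] // h.
suff E12 : V1 = V2.
  move: h12; rewrite E12 /eucl_dist subrr dotpE !mxE !mul0r addr0 sqrtr0 => h0.
  by move: r_gt0; rewrite -h0 ltxx.
apply: vec2P.
  have := congr1 (fun u : 'rV[R]_2 => u ord0 ord0) h.
  by rewrite /antipode !mxE; lra.
have := congr1 (fun u : 'rV[R]_2 => u ord0 ord_max) h.
by rewrite /antipode !mxE; lra.
Qed.
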